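(* Let $N\ge9$, $\alpha\in\{2,3,4\}$ with $\alpha\mid N$, and $M_\alpha=N/\alpha$. Let $g$ be a $2\times5$ matrix over $\mathbb{Z}_N$ generating an admissible linear code, with columns indexed by $i=0,\dots,4$ and $\gcd_i=\gcd(g_{1i},g_{2i},N)$. Suppose exactly one column of $g$ has $\gcd_i=M_\alpha$ and the other columns have $\gcd_i<M_\alpha$. Then $g$ does not generate a thin linear code, unless $g$ has a column of zeros.
   Context: $\mathbb{Z}_N=\mathbb{Z}/N\mathbb{Z}$; its elements are identified with the representatives $0,1,\dots,N-1$, and gcd's are taken of these integers. The code generated by $g$ is the submodule of $\mathbb{Z}_N^5$ generated by the rows of $g$. A linear code is extended if every word has coordinate sum $0\bmod N$; call it admissible if it is extended and the greatest common divisor of $N$ and all entries of all words (equivalently of $N$ and all entries of $g$) is $1$. An extended code is thin if it contains no word all of whose entries are nonzero. *)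

(* Defs.v *)
From mathcomp Require Import all_boot all_order all_algebra.

Set Implicit Arguments.
Unset Strict Implicit.
Unset Printing Implicit Defensive.

Import GRing.Theory.
Local Open Scope ring_scope.

(* Words of length n over Z/NZ are row vectors over 'Z_N.  This is Z/NZ only
   for 1 < N; the coercion of 'Z_N to nat then returns the representative in
   {0, ..., N-1}, and it is what every gcd below is taken of. *)

Definition code_of (N m n : nat) (g : 'M['Z_N]_(m, n)) : {set 'rV['Z_N]_n} :=
  [set u *m g | u : 'rV['Z_N]_m].

Definition extended (N n : nat) (C : {set 'rV['Z_N]_n}) : bool :=
  [forall w in C, \sum_(i < n) w 0 i == 0].

Definition code_gcd (N n : nat) (C : {set 'rV['Z_N]_n}) : nat :=
  \big[gcdn/N]_(w in C) \big[gcdn/N]_(i < n) (w 0 i : nat).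

Definition admissible (N n : nat) (C : {set 'rV['Z_N]_n}) : bool :=
  extended C && (code_gcd C == 1%N).

Definition thin (N n : nat) (C : {set 'rV['Z_N]_n}) : bool :=
  extended C && ~~ [exists w in C, [forall i, w 0 i != 0]].

(* Since gcdn 0 N = N, a zero column has column gcd N. *)
Definition col_gcd (N m n : nat) (g : 'M['Z_N]_(m, n)) (i : 'I_n) : nat :=
  \big[gcdn/N]_(r < m) (g r i : nat).

(* Main.v *)
(* Let k_i = N / gcd_i be the order of column i as a functional on Z_N^2, so
   alpha = k_(i0) and k_i > alpha otherwise.  If every word has a zero entry, the
   zero sets of the remaining columns cover the coset E where column i0 takes the
   value M_alpha.  Since E generates a cyclic quotient, column i vanishes on at
   most |E| / k_i points of E; so if n columns remain and all k_i >= n, then all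
   k_i = n.  As the columns sum to zero, N divides every common multiple of the
   k_i with i <> i0, so N | n, contradicting N >= 9.  Here n = 4 works, unless
   alpha = 2 and k_(i1) = 3 for some i1; then E is cut down to the coset where the
   columns i0 and i1 both take a prescribed nonzero value, again a generator of a
   cyclic quotient as 2 and 3 are coprime, and n = 3 works. *)
Require Import Defs.
From HB Require Import structures.
From mathcomp Require Import all_boot all_order all_algebra.
From mathcomp Require Import zify.

Set Implicit Arguments.
Unset Strict Implicit.
Unset Printing Implicit Defensive.

Import GRing.Theory.
Local Open Scope ring_scope.

Lemma card_zeros_coset (G : finZmodType) (A : zmodType)
    (c : {additive G -> A}) (E : {set G}) (k : nat) (y : G) :
    (forall z, z \in E -> exists m, forall x, x \in E -> x + (y - z *+ m) \in E) ->
    (forall j, (0 < j < k)%N -> c y *+ j != 0) ->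
  (#|[set x in E | (c x == 0)%R]| * k <= #|E|)%N.
Proof.
move=> cosetE ord_cy; set Z := [set x in E | _].
have [->|[z]] := set_0Vmem Z; first by rewrite cards0.
rewrite inE => /andP[Ez /eqP cz0]; have [m Em] := cosetE z Ez.
set v := y - z *+ m in Em.
have cv : c v = c y by rewrite raddfB raddfMn cz0 mul0rn subr0.
pose f (p : G * 'I_k) := p.1 + v *+ p.2.
have cf p : p \in setX Z [set: 'I_k] -> c (f p) = c y *+ p.2.
  rewrite !inE => /andP[/andP[_ /eqP c0] _].
  by rewrite raddfD raddfMn c0 add0r cv.
have lt_neq (i j : 'I_k) : (i < j)%N -> c y *+ i != c y *+ j.
  move=> lt_ij; rewrite eq_sym -subr_eq0 -mulrnBr ?(ltnW lt_ij) //.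
  by apply: ord_cy; have := ltn_ord j; lia.
have f_inj : {in setX Z [set: 'I_k] &, injective f}.
  move=> p q Zp Zq eq_f; have := congr1 c eq_f; rewrite !cf // => eq_c.
  have eq2 : p.2 = q.2.
    apply: val_inj; have [/lt_neq|/lt_neq|//] := ltngtP p.2 q.2.
      by rewrite eq_c eqxx.
    by rewrite eq_c eqxx.
  move: eq_f; rewrite /f eq2 => /addIr eq1.
  by case: p q eq1 eq2 {Zp Zq eq_c} => [? ?] [? ?] /= -> ->.
have <- : #|setX Z [set: 'I_k]| = (#|Z| * k)%N by rewrite cardsX cardsT card_ord.
rewrite -(card_in_imset f_inj); apply/subset_leq_card/subsetP => _ /imsetP[p Zp ->].
move: Zp; rewrite !inE => /andP[/andP[Ep _] _]; rewrite /f.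
elim: (p.2 : nat) => [|j IHj]; first by rewrite mulr0n addr0.
by rewrite mulrSr addrA Em.
Qed.

Lemma tight_cover (T I : finType) (E : {set T}) (Z : I -> {set T}) (P : {set I})
    (k : I -> nat) :
    E != set0 -> E \subset \bigcup_(i in P) Z i ->
    {in P, forall i, #|P| <= k i}%N -> {in P, forall i, #|Z i| * k i <= #|E|}%N ->
  {in P, forall i, k i = #|P|}.
Proof.
rewrite -card_gt0 => E_gt0 coverE k_ge Z_le i Pi.
have le_sum : (#|E| <= \sum_(j in P) #|Z j|)%N.
  apply: leq_trans (subset_leq_card coverE) _.
  elim/big_rec2: _ => [|j n A _ le_An]; first by rewrite cards0.
  by apply: leq_trans (leq_card_setU _ _) _; rewrite leq_add2l.
have le_rest : (#|P| * (\sum_(j in P | j != i) #|Z j|) <= #|P|.-1 * #|E|)%N.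
  rewrite big_distrr /=.
  have <- : #|P :\ i| = #|P|.-1 by rewrite (cardsD1 i P) Pi.
  have -> : (#|P :\ i| * #|E| = \sum_(j in P | j != i) #|E|)%N.
    rewrite -sum_nat_const; apply: eq_bigl => j.
    by rewrite !inE andbC.
  apply: leq_sum => j /andP[Pj _]; apply: leq_trans (Z_le j Pj).
  by rewrite mulnC leq_mul2l k_ge ?orbT.
have P_gt0 : (0 < #|P|)%N by apply/card_gt0P; exists i.
move: le_sum; rewrite (bigD1 i) //=.
have := Z_le i Pi; have := k_ge i Pi.
move: le_rest; move: (\sum_(_ in P | _) _)%N => s.
move: #|E| #|Z i| #|P| (k i) E_gt0 P_gt0 => e z p q e_gt0 p_gt0 h1 h2 h3 h4.
have : (e <= p * z)%N by nia.
nia.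
Qed.

Definition coord (N m n : nat) (g : 'M['Z_N]_(m, n)) (i : 'I_n) (u : 'rV['Z_N]_m) :
  'Z_N := (u *m g) 0 i.

Lemma coord_is_zmod_morphism (N m n : nat) (g : 'M['Z_N]_(m, n)) (i : 'I_n) :
  zmod_morphism (coord g i).
Proof. by move=> u v; rewrite /coord mulmxBl !mxE. Qed.

HB.instance Definition _ (N m n : nat) (g : 'M['Z_N]_(m, n)) (i : 'I_n) :=
  GRing.isZmodMorphism.Build _ _ (coord g i) (coord_is_zmod_morphism g i).

Section CoordMorphism.
Variables (N m n : nat) (g : 'M['Z_N]_(m, n)) (i : 'I_n).

Lemma coord0 : coord g i 0 = 0. Proof. exact: raddf0. Qed.
Lemma coordD : {morph coord g i : u v / u + v}. Proof. exact: raddfD. Qed.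
Lemma coordB : {morph coord g i : u v / u - v}. Proof. exact: raddfB. Qed.
Lemma coordMn q : {morph coord g i : u / u *+ q}. Proof. exact: raddfMn. Qed.

End CoordMorphism.

Lemma Zp_nat_eq0 (N a : nat) : (1 < N)%N -> ((a%:R : 'Z_N) == 0) = (N %| a)%N.
Proof.
by move=> N_gt1; rewrite -val_eqE /= val_Zp_nat.
Qed.

Section Columns.
Variables (N m n : nat) (g : 'M['Z_N]_(m, n)).
Hypothesis N_gt1 : (1 < N)%N.

Lemma col_gcd_dvdN (i : 'I_n) : (col_gcd g i %| N)%N.
Proof.
rewrite /col_gcd.
elim/big_rec: _ => // r d _ dN; exact: dvdn_trans (dvdn_gcdr _ _) dN.
Qed.

Lemma col_gcd_dvd (i : 'I_n) (r : 'I_m) : (col_gcd g i %| g r i)%N.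
Proof. by rewrite /col_gcd (bigD1 r) //= dvdn_gcdl. Qed.

Lemma coord_col_gcd (i : 'I_n) : exists y, coord g i y = (col_gcd g i)%:R.
Proof.
rewrite /col_gcd; elim/big_ind: _ => [|a b [ya ya_a] [yb yb_b]|r _].
- by exists 0; rewrite coord0; apply/esym/eqP; rewrite Zp_nat_eq0.
- have [->|a_gt0] := posnP a; first by exists yb; rewrite gcd0n.
  have [u _ /dvdnP[q eq_q]] := Bezoutl b a_gt0.
  exists (ya *+ q - yb *+ u); rewrite coordB !coordMn ya_a yb_b -!mulrnA.
  by rewrite (mulnC a) -eq_q natrD (mulnC u) addrK.
exists (delta_mx 0 r); rewrite natr_Zp /coord mxE (bigD1 r) //= big1.
  by rewrite mxE !eqxx mul1r addr0.
by move=> s /negbTE r's; rewrite mxE eqxx r's mul0r.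
Qed.

Lemma coord_multiple (i : 'I_n) (x : 'rV_m) :
  exists a, coord g i x = (a * col_gcd g i)%:R.
Proof.
rewrite /coord mxE; elim/big_rec: _ => [|r _ _ [a ->]]; first by exists 0%N.
have /dvdnP[b eq_b] := col_gcd_dvd i r.
exists (x 0%R r * b + a)%N; rewrite mulnDl -mulnA -eq_b natrD !natrM.
by rewrite !natr_Zp.
Qed.

Definition col_order (i : 'I_n) : nat := N %/ col_gcd g i.

Lemma col_orderE (i : 'I_n) : (col_order i * col_gcd g i)%N = N.
Proof. by rewrite divnK // col_gcd_dvdN. Qed.

Lemma coord_mul_order (i : 'I_n) (q : nat) (x : 'rV_m) :
  (col_order i %| q)%N -> coord g i x *+ q = 0.
Proof.
move=> /dvdnP[b ->]; have [a ->] := coord_multiple i x.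
apply/eqP; rewrite -mulrnA Zp_nat_eq0 //; apply/dvdnP; exists (a * b)%N.
by rewrite -[N in RHS](col_orderE i); lia.
Qed.

Lemma card_coord_zeros_coset (E : {set 'rV['Z_N]_m}) (i : 'I_n) :
    (forall y z, z \in E ->
       exists q, forall x, x \in E -> x + (y - z *+ q) \in E) ->
  (#|[set x in E | (coord g i x == 0)%R]| * col_order i <= #|E|)%N.
Proof.
move=> cosetE; have [y def_y] := coord_col_gcd i.
apply: (@card_zeros_coset _ _ (coord g i) _ _ y) => [z /cosetE //|j].
rewrite /= def_y -mulrnA Zp_nat_eq0 // => /andP[j_gt0 lt_j].
have := col_orderE i; apply: contra_eqN => /dvdnP[[|a] def_j]; nia.
Qed.

Hypothesis g_adm : admissible (code_of g).

Lemma sum_coord (x : 'rV['Z_N]_m) : \sum_i coord g i x = 0.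
Proof.
case/andP: g_adm => /forall_inP ext _; apply/eqP/ext.
exact: imset_f.
Qed.

Lemma dvd_of_col_order (i0 : 'I_n) (q : nat) :
  (forall i, i != i0 -> (col_order i %| q)%N) -> (N %| q)%N.
Proof.
move=> dvd_q.
have all0 i x : coord g i x *+ q = 0.
  have [->|/dvd_q] := eqVneq i i0; last exact: coord_mul_order.
  have := sum_coord x; rewrite (bigD1 i0) //= => /(congr1 (fun t => t *+ q)).
  rewrite mulrnDl mul0rn -sumrMnl big1 ?addr0 // => j /dvd_q; exact: coord_mul_order.
case/andP: g_adm => _ /eqP gcd1; rewrite -[q]mul1n -gcd1.
suff : forall a, (N %| a * q)%N = (N %/ gcdn N q %| a)%N.
  move=> dvdE; rewrite dvdE /code_gcd.
  have dvdN : (N %/ gcdn N q %| N)%N.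
    by apply/dvdnP; exists (gcdn N q); rewrite mulnC divnK ?dvdn_gcdl.
  elim/big_ind: _ => // [a b da db|w /imsetP[x _ ->]]; first by rewrite dvdn_gcd da.
  elim/big_ind: _ => // [a b da db|i _]; first by rewrite dvdn_gcd da.
  rewrite -dvdE -Zp_nat_eq0 // natrM natr_Zp mulr_natr; exact/eqP/all0.
move=> a; have d_gt0 : (0 < gcdn N q)%N by rewrite gcdn_gt0; lia.
have [dN dq] := (dvdn_gcdl N q, dvdn_gcdr N q).
rewrite -[X in (X %| _)%N](divnK dN) -[X in (_ %| a * X)%N = _](divnK dq) mulnA dvdn_pmul2r //.
rewrite Gauss_dvdl //.
by rewrite /coprime -(eqn_pmul2r d_gt0) muln_gcdl !divnK // mul1n.
Qed.

Hypothesis g_thin : thin (code_of g).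

Lemma thin_zero_coord (x : 'rV['Z_N]_m) : exists i, coord g i x == 0.
Proof.
case/andP: g_thin => _ /exists_inPn /(_ (x *m g)) -/(_ (imset_f _ _)) -/(_ isT).
by rewrite negb_forall => /existsP[i]; rewrite negbK; exists i.
Qed.

Lemma thin_col_order (E : {set 'rV['Z_N]_m}) (P : {set 'I_n}) :
    E != set0 ->
    (forall y z, z \in E ->
       exists q, forall x, x \in E -> x + (y - z *+ q) \in E) ->
    (forall x i, x \in E -> i \notin P -> coord g i x != 0) ->
    {in P, forall i, #|P| <= col_order i}%N ->
  {in P, forall i, col_order i = #|P|}.
Proof.
move=> E_n0 cosetE outP P_le.
apply: (@tight_cover _ _ E (fun i => [set x in E | coord g i x == 0])) => //.
  apply/subsetP => x Ex; have [i xi0] := thin_zero_coord x.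
  apply/bigcupP; exists i; last by rewrite inE Ex.
  by apply: contraLR xi0 => /outP; apply.
by move=> i _; apply: card_coord_zeros_coset.
Qed.

End Columns.

Theorem lemma3p6 (N alpha : nat) (g : 'M['Z_N]_(2, 5))
    (hN : (9 <= N)%N)
    (halpha : alpha \in [:: 2; 3; 4]%N)
    (hdvd : (alpha %| N)%N)
    (hadm : admissible (code_of g))
    (hcol : exists i0 : 'I_5,
        col_gcd g i0 = (N %/ alpha)%N /\
        forall i : 'I_5, i != i0 -> (col_gcd g i < N %/ alpha)%N) :
  ~ thin (code_of g) \/ exists i : 'I_5, col i g = 0.
Proof.
left=> g_thin; have N_gt1 : (1 < N)%N by lia.
case: hcol => i0 [gcd0 gcd_lt].
have alpha_ge2 : (2 <= alpha)%N by move: halpha; rewrite !inE; lia.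
have ord_i0 : col_order g i0 = alpha.
  have := col_orderE g i0; have := divnK hdvd; rewrite -gcd0; nia.
have ord_gt i : i != i0 -> (alpha < col_order g i)%N.
  move=> /gcd_lt; have := col_orderE g i; have := divnK hdvd; nia.
have no_dvd q : (0 < q < 9)%N -> ~ (forall i, i != i0 -> (col_order g i %| q)%N).
  move=> /andP[q_gt0 q_lt9] /(dvd_of_col_order N_gt1 hadm) /(dvdn_leq q_gt0); lia.
have [y0 def_y0] := coord_col_gcd g N_gt1 i0.
have nat_eq0 := @Zp_nat_eq0 N _ N_gt1.
have y0_n0 : coord g i0 y0 != 0.
  rewrite def_y0 nat_eq0; have := col_orderE g i0; rewrite ord_i0.
  apply: contra_eqN => /dvdnP[[|a] def_d]; nia.
have [/existsP[i1 /andP[i1_n0 /eqP ord_i1]]|no3] :=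
    boolP [exists i1, (i1 != i0) && (col_order g i1 == 3)].
  have alpha2 : alpha = 2%N by have := ord_gt _ i1_n0; lia.
  have [y1 def_y1] := coord_col_gcd g N_gt1 i1.
  have y1_n0 : coord g i1 y1 != 0.
    rewrite def_y1 nat_eq0; have := col_orderE g i1; rewrite ord_i1.
    apply: contra_eqN => /dvdnP[[|a] def_d]; nia.
  have mul2 x : coord g i0 x *+ 2 = 0 by rewrite coord_mul_order // ord_i0 alpha2.
  have mul3 x : coord g i1 x *+ 3 = 0 by rewrite coord_mul_order // ord_i1.
  pose E := [set x | (coord g i0 x == coord g i0 y0) && (coord g i1 x == coord g i1 y1)].
  pose P := [set i | (i != i0) && (i != i1)].
  have P3 : #|P| = 3%N.
    have -> : P = ~: [set i0; i1] by apply/setP => i; rewrite !inE negb_or.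
    by have := cardsC [set i0; i1]; rewrite cards2 eq_sym i1_n0 card_ord; lia.
  have ordP : {in P, forall i, col_order g i = #|P|}.
    apply: (@thin_col_order _ _ _ g N_gt1 g_thin E).
    - apply/set0Pn; exists (y0 *+ 3 - y1 *+ 2); rewrite inE !coordB !coordMn.
      rewrite [in X in X && _]mulrSr !mul2 mul3 add0r subr0 eqxx /= sub0r.
      by rewrite eq_sym -addr_eq0 -mulrS mul3.
    - move=> y z; rewrite inE => /andP[/eqP z0 /eqP z1].
      have [a] := coord_multiple g i0 y; have [b] := coord_multiple g i1 y.
      rewrite !natrM !mulr_natl -def_y0 -def_y1 => y_b y_a.
      (* [3 a + 4 b] is congruent to [a] mod 2 and to [b] mod 3. *)
      exists (3 * a + 4 * b)%N => x; rewrite !inE => /andP[/eqP x0 /eqP x1].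
      rewrite 2![coord _ _ (x + _)]coordD !coordB !coordMn x0 x1 y_a y_b z0 z1.
      have -> : (3 * a + 4 * b = a + 2 * (a + 2 * b))%N by lia.
      rewrite [in X in X && _]mulrnDr [in X in X && _]mulrnA mul2 mul0rn addr0.
      have -> : (a + 2 * (a + 2 * b) = b + 3 * (a + b))%N by lia.
      by rewrite mulrnDr [_ *+ (3 * _)]mulrnA mul3 mul0rn !addr0 !subrr !addr0 !eqxx.
    - move=> x i; rewrite !inE negb_and !negbK => /andP[/eqP x0 /eqP x1].
      by case/orP=> /eqP ->; rewrite ?x0 ?x1.
    - by move=> i; rewrite P3 inE => /andP[/ord_gt]; rewrite alpha2.
  apply: (no_dvd 3%N) => // i i_n0.
  have [->|i_n1] := eqVneq i i1; first by rewrite ord_i1.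
  by rewrite ordP ?P3 // inE i_n0.
pose E := [set x | coord g i0 x == coord g i0 y0].
have P4 : #|[set~ i0]| = 4%N by rewrite cardsC1 card_ord.
have ordP : {in [set~ i0], forall i, col_order g i = #|[set~ i0]|}.
  apply: (@thin_col_order _ _ _ g N_gt1 g_thin E).
  - by apply/set0Pn; exists y0; rewrite inE.
  - move=> y z; rewrite inE => /eqP z0; have [q def_y] := coord_multiple g i0 y.
    exists q => x; rewrite !inE => /eqP x0.
    by rewrite coordD coordB coordMn z0 x0 def_y0 def_y natrM mulr_natl subrr addr0.
  - by move=> x i; rewrite !inE negbK => /eqP x0 /eqP ->; rewrite x0.
  - move=> i; rewrite P4 !inE => i_n0; have := ord_gt i i_n0.
    move: no3; rewrite negb_exists => /forallP/(_ i); rewrite i_n0 /=; lia.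
apply: (no_dvd 4%N) => // i i_n0; by rewrite ordP ?P4 // !inE.
Qed.
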